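(* Let $\Gamma$ be an abelian group and let $R$ be a $\Gamma$-graded gr-prime ring. Then there is a canonical decomposition (internal direct sum of additive groups) $$p\mathfrak{Der}^{gh}_\Gamma(R)=p\mathfrak{Der}^{h}_\Gamma(R)\oplus\mathcal{C}_\Gamma(R),$$ where $\mathcal{C}_\Gamma(R)=\{F\in p\mathfrak{Der}^{gh}_\Gamma(R): F\text{ has zero associated derivation}\}$.
   Context: A ring $R$ is $\Gamma$-graded if $R=\bigoplus_{\tau\in\Gamma}R_\tau$ as additive groups with $R_\tau R_\sigma\subseteq R_{\tau\sigma}$; the set of homogeneous elements is $\mathcal{H}(R)=\bigcup_{\tau}R_\tau$. $R$ is gr-prime if for $a,b\in\mathcal{H}(R)$, $aRb=0$ implies $a=0$ or $b=0$. $p\mathfrak{Der}^{gh}_\Gamma(R)$ is the set of gr-generalized derivations of $R$: pairs $(F,d)_h$ where $d:R\to R$ is a derivation (additive, $d(xy)=d(x)y+xd(y)$), $F:R\to R$ is additive with $F(xy)=F(x)y+xd(y)$ for all $x,y\in R$, and $F(R_\tau)\subseteq R_\tau$, $d(R_\tau)\subseteq R_\tau$ for all $\tau\in\Gamma$; $d$ is called the associated derivation of $F$. It is an additive group under pointwise (componentwise) addition. $p\mathfrak{Der}^{h}_\Gamma(R)$ is the set of derivations $d$ of $R$ with $d(R_\tau)\subseteq R_\tau$ for all $\tau$, regarded inside $p\mathfrak{Der}^{gh}_\Gamma(R)$ via $d\mapsto(d,d)_h$. Elements of $\mathcal{C}_\Gamma(R)$ are the pairs $(F,0)_h$ in $p\mathfrak{Der}^{gh}_\Gamma(R)$.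 *)

(* Defs.v *)
From HB Require Import structures.
From mathcomp Require Import all_boot all_algebra.
From mathcomp Require Import boolp classical_sets functions cardinality fsbigop.

Set Implicit Arguments.
Unset Strict Implicit.
Unset Printing Implicit Defensive.

Import GRing.Theory.

Local Open Scope classical_set_scope.
Local Open Scope ring_scope.

(* Associative rings, not assumed to have a unit or to be commutative: the
   ring structures of MathComp all carry a unit, while gr-prime rings need
   not have one. *)
HB.mixin Record isRng R of Semigroup R & GRing.Zmodule R := {
  rngDl : left_distributive (@monoid.mul R) (@GRing.add R);
  rngDr : right_distributive (@monoid.mul R) (@GRing.add R)
}.

#[short(type="rngType")]
HB.structure Definition Rng := {R of Semigroup R & GRing.Zmodule R & isRng R}.

Notation "x ∙ y" := (monoid.mul x%R y%R) (at level 40, left associativity) : ring_scope.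

(* Unital rings are covered, through this alias. *)
Definition rng_of (R : pzRingType) : Type := R.

HB.instance Definition _ (R : pzRingType) := GRing.Zmodule.on (rng_of R).
HB.instance Definition _ (R : pzRingType) :=
  hasMul.Build (rng_of R) (@GRing.mul R).
HB.instance Definition _ (R : pzRingType) :=
  Magma_isSemigroup.Build (rng_of R) (@mulrA R).
HB.instance Definition _ (R : pzRingType) :=
  isRng.Build (rng_of R) (@mulrDl R) (@mulrDr R).

Definition subgroup (V : zmodType) (A : set V) : Prop :=
  zmod_closed (mem A).

(* W is the internal direct sum of its subgroups A and B. *)
Definition direct_sum2 (V : zmodType) (W A B : set V) : Prop :=
  [/\ subgroup W, subgroup A, subgroup B,
      W = [set a + b | a in A & b in B]
    & A `&` B = [set 0]].

(* V is the internal direct sum of the family of subgroups A, indexed by an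
   arbitrary, possibly infinite, type I. The finiteness clause is needed: a sum
   over setT is 0 by convention when its support is infinite. *)
Definition direct_sum (I : choiceType) (V : zmodType) (A : I -> set V) : Prop :=
  (forall i, subgroup (A i)) /\
  (forall x : V, exists! f : I -> V,
     [/\ forall i, A i (f i),
         finite_set [set i | f i <> 0]
       & x = \sum_(i \in [set: I]) f i]).

(* The abelian group G of degrees is written additively. *)
Record grading (G : zmodType) (R : rngType) := Grading {
  component :> G -> set R;
  grading_direct_sum : direct_sum component;
  grading_mul : forall (s t : G) (x y : R),
    component s x -> component t y -> component (s + t) (x ∙ y)
}.

Section GradedRing.
Variables (G : zmodType) (R : rngType) (gr : grading G R).

Definition homogeneous : set R := \bigcup_(t in [set: G]) gr t.

Definition gr_prime : Prop :=
  forall a b : R, homogeneous a -> homogeneous b ->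
    (forall r : R, a ∙ r ∙ b = 0) -> a = 0 \/ b = 0.

Definition preserves_degree (f : R -> R) : Prop :=
  forall (t : G) (x : R), gr t x -> gr t (f x).

Definition derivation (d : R -> R) : Prop :=
  {morph d : x y / x + y} /\
  (forall x y : R, d (x ∙ y) = d x ∙ y + x ∙ d y).

Definition generalized_derivation (F d : R -> R) : Prop :=
  [/\ derivation d,
      {morph F : x y / x + y}
    & forall x y : R, F (x ∙ y) = F x ∙ y + x ∙ d y].

Definition gr_derivations : set (R -> R) :=
  [set d | derivation d /\ preserves_degree d].

Definition gr_generalized_derivations : set ((R -> R) * (R -> R)) :=
  [set Fd | [/\ generalized_derivation Fd.1 Fd.2,
                preserves_degree Fd.1 & preserves_degree Fd.2]].

Definition gr_derivation_pairs : set ((R -> R) * (R -> R)) :=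
  [set (d, d) | d in gr_derivations].

Definition gr_zero_derivation_pairs : set ((R -> R) * (R -> R)) :=
  [set Fd | gr_generalized_derivations Fd /\ Fd.2 = 0].

End GradedRing.

(* Main.v *)
Require Import Defs.
From mathcomp Require Import all_boot all_algebra.
From mathcomp Require Import boolp classical_sets functions cardinality fsbigop.

(** The associated derivation is part of the data of a gr-generalized
    derivation, so (F, d) |-> (d, d) is a well-defined additive map.  It sends
    gr-generalized derivations to gr-generalized derivations, because the
    Leibniz rule of d is the generalized Leibniz rule of the pair (d, d), and
    it is idempotent.  Its image is the group of pairs (d, d) and its kernel
    the group of pairs (F, 0), so the decomposition is that of an idempotent
    endomorphism into image and kernel: (F, d) = (d, d) + (F - d, 0).

    The three sets are subgroups because the image is the intersection of
    the group of gr-generalized derivations with the diagonal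
    ([gr_derivation_pairsE]), and the kernel is its intersection with the
    pairs of second component 0; so the only closure statement that involves
    products and degrees is [subgroup_gr_generalized_derivations]. *)

Set Implicit Arguments.
Unset Strict Implicit.
Unset Printing Implicit Defensive.

Import GRing.Theory.

Local Open Scope classical_set_scope.
Local Open Scope ring_scope.

Section Subgroups.
Variable V : zmodType.
Implicit Types A B : set V.

Lemma subgroupP A :
  subgroup A <-> A 0 /\ (forall x y, A x -> A y -> A (x - y)).
Proof.
split=> -[A0 AB]; split.
- exact: (set_mem A0).
- by move=> x y Ax Ay; apply: set_mem; apply: AB; apply: mem_set.
- exact: (mem_set A0).
- by move=> x y /set_mem Ax /set_mem Ay; apply: mem_set; apply: AB.
Qed.

Lemma subgroupI A B : subgroup A -> subgroup B -> subgroup (A `&` B).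
Proof.
move=> /subgroupP[A0 AB] /subgroupP[B0 BB]; apply/subgroupP.
by split=> // x y [Ax Bx] [Ay By]; split; [apply: AB|apply: BB].
Qed.

End Subgroups.

Lemma subgroup_diagonal (V : zmodType) : subgroup [set p : V * V | p.1 = p.2].
Proof. by apply/subgroupP; split=> // p q /= -> ->. Qed.

Lemma subgroup_snd0 (V : zmodType) : subgroup [set p : V * V | p.2 = 0].
Proof. by apply/subgroupP; split=> // p q /= -> ->; rewrite subr0. Qed.

Section RngTheory.
Variable R : rngType.
Implicit Types (x y z : R) (f g : R -> R).

Lemma rngBl x y z : (x - y) ∙ z = x ∙ z - y ∙ z.
Proof. by apply/eqP; rewrite eq_sym subr_eq -rngDl subrK. Qed.

Lemma rngBr x y z : x ∙ (y - z) = x ∙ y - x ∙ z.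
Proof. by apply/eqP; rewrite eq_sym subr_eq -rngDr subrK. Qed.

Lemma rng0l x : 0 ∙ x = 0.
Proof. by rewrite -[X in X ∙ _](subrr x) rngBl subrr. Qed.

Lemma rng0r x : x ∙ 0 = 0.
Proof. by rewrite -[X in _ ∙ X](subrr x) rngBr subrr. Qed.

Lemma morph_addB f g :
  {morph f : x y / x + y} -> {morph g : x y / x + y} ->
  {morph f - g : x y / x + y}.
Proof. by move=> fD gD x y; rewrite !fctE fD gD opprD addrACA. Qed.

Lemma generalized_derivation_diag (d : R -> R) :
  generalized_derivation d d <-> derivation d.
Proof. by split=> [[]|dd]//; case: (dd) => dD dM; split. Qed.

Lemma generalized_derivation0 : @generalized_derivation R 0 0.
Proof.
have zeroE z : (0 : R -> R) z = 0 by [].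
apply/generalized_derivation_diag; split=> x y; rewrite !zeroE ?addr0//.
by rewrite rng0l rng0r addr0.
Qed.

(** The rule F(xy) = F(x)y + x d(y) is jointly linear in the pair (F, d); the
    Leibniz rule of d is its instance (d, d). *)
Lemma generalized_leibnizB (F d F' d' : R -> R) :
  (forall x y, F (x ∙ y) = F x ∙ y + x ∙ d y) ->
  (forall x y, F' (x ∙ y) = F' x ∙ y + x ∙ d' y) ->
  forall x y, (F - F') (x ∙ y) = (F - F') x ∙ y + x ∙ (d - d') y.
Proof.
by move=> FM FM' x y; rewrite !fctE FM FM' opprD addrACA -rngBl -rngBr.
Qed.

Lemma generalized_derivationB (F d F' d' : R -> R) :
  generalized_derivation F d -> generalized_derivation F' d' ->
  generalized_derivation (F - F') (d - d').
Proof.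
move=> [[dD dM] FD FM] [[dD' dM'] FD' FM'].
by split; [split| |]; first [exact: morph_addB|exact: generalized_leibnizB].
Qed.

End RngTheory.

Section GradedDerivations.
Variables (G : zmodType) (R : rngType) (gr : grading G R).

Lemma component0 t : gr t 0.
Proof. by have /subgroupP[] := (grading_direct_sum gr).1 t. Qed.

Lemma componentB t x y : gr t x -> gr t y -> gr t (x - y).
Proof. by have /subgroupP[_] := (grading_direct_sum gr).1 t; apply. Qed.

Lemma preserves_degreeB (f g : R -> R) :
  preserves_degree gr f -> preserves_degree gr g ->
  preserves_degree gr (f - g).
Proof.
by move=> hf hg t x tx; apply: componentB; [apply: hf|apply: hg].
Qed.

Lemma subgroup_gr_generalized_derivations :
  subgroup (gr_generalized_derivations gr).
Proof.
apply/subgroupP; split.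
  split; first exact: generalized_derivation0.
  - by move=> t x _; apply: component0.
  - by move=> t x _; apply: component0.
move=> p q [gp p1 p2] [gq q1 q2]; split; first exact: generalized_derivationB.
- exact: preserves_degreeB.
- exact: preserves_degreeB.
Qed.

(** On the diagonal both multiplication rules coincide; this form makes the
    subgroup property a matter of intersecting two subgroups. *)
Lemma gr_derivation_pairsE :
  gr_derivation_pairs gr =
  gr_generalized_derivations gr `&` [set p | p.1 = p.2].
Proof.
apply/seteqP; split.
  move=> _ [d [dd dgr] <-]; split=> //.
  by split=> //; apply/generalized_derivation_diag.
by move=> [F d] [[/= [dd _ _] _ dgr] /= ->]; exists d.
Qed.

Lemma gr_derivation_pair_snd p :
  gr_generalized_derivations gr p -> gr_derivation_pairs gr (p.2, p.2).
Proof. by case=> -[dd _ _] _ dgr; exists p.2. Qed.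

End GradedDerivations.

Theorem theorem4p2 (G : zmodType) (R : rngType) (gr : grading G R)
    (gr_primeR : gr_prime gr) :
  direct_sum2 (gr_generalized_derivations gr)
              (gr_derivation_pairs gr) (gr_zero_derivation_pairs gr).
Proof.
have sW := subgroup_gr_generalized_derivations gr.
have sA : subgroup (gr_derivation_pairs gr).
  by rewrite gr_derivation_pairsE; apply: subgroupI => //;
     apply: subgroup_diagonal.
have sB : subgroup (gr_zero_derivation_pairs gr).
  by apply: subgroupI => //; apply: subgroup_snd0.
have AW : gr_derivation_pairs gr `<=` gr_generalized_derivations gr.
  by rewrite gr_derivation_pairsE => p [].
have /subgroupP[W0 WB] := sW.
split=> //.
- apply/seteqP; split=> [p Wp|_ [a /AW Wa [b [Wb _] <-]]].
    have Ap := gr_derivation_pair_snd Wp.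
    exists (p.2, p.2) => //; exists (p - (p.2, p.2)); last by rewrite addrC subrK.
    by split; [apply: WB => //; apply: AW|apply: subrr].
  (* Closure is stated for differences: a + b = a - (0 - b). *)
  by rewrite -[b]opprK -[- b]sub0r; apply: (WB _ _ Wa); apply: WB.
- apply/seteqP; split=> [p|_ ->]; last first.
    by split; [have /subgroupP[] := sA|have /subgroupP[] := sB].
  by rewrite gr_derivation_pairsE => -[[_ /= p12] [_ p20]];
     case: p p12 p20 => F d /= -> ->.
Qed.
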